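(* Let $(P,\eta,H,M,F)$ be a constrained Hamiltonian system satisfying the mechanical condition $\mathrm{d}H|_M\in({}^{\bot}F)^{\circ}$, with $\mathcal{R}|_M$ tangent to $F$, ${}^{\bot}F\subseteq F$, ${}^{\bot}F\cap TM=\{0\}$ and $\operatorname{rank}(F)=\dim(M)$. Then the nonholonomic bracket $\{\cdot,\cdot\}_{H,M}$ and the $\mathrm{P}$-nonholonomic bracket $\{\cdot,\cdot\}^{\mathrm{P}}_{H,M}$ on $C^\infty(M)$ coincide.
   Context: A contact manifold $(P,\eta)$ of dimension $2n+1$ is a manifold with a $1$-form $\eta$ such that $\eta\wedge(\mathrm{d}\eta)^n$ is a volume form. The map $\flat:TP\to T^*P$, $\flat(v)=\iota_v\mathrm{d}\eta+\eta(v)\eta$, is a vector bundle isomorphism with inverse $\sharp$. The Reeb vector field $\mathcal{R}$ is determined by $\iota_{\mathcal{R}}\mathrm{d}\eta=0$, $\eta(\mathcal{R})=1$. The Jacobi bivector of $\eta$ is $\Lambda(\alpha,\beta)=-\mathrm{d}\eta(\sharp\alpha,\sharp\beta)$. A constrained Hamiltonian system $(P,\eta,H,M,F)$ consists of a contact manifold, a smooth function $H:P\to\mathbb{R}$, an embedded submanifold $M\subseteq P$ and a vector subbundle $F$ of $T_MP$ (the restriction of $TP$ to $M$). For a subbundle $D\subseteq T_MP$, $D^{\circ}$ is its annihilator in $T^*_MP$ and ${}^{\bot}D=\sharp(D^{\circ})=\{v:\mathrm{d}\eta(v,w)+\eta(v)\eta(w)=0\ \forall w\in D\}$. Under the hypotheses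 one has two splittings along $M$: $T_MP={}^{\bot}F\oplus TM$, with projection $\mathcal{P}:T_MP\to TM$, and $T_MP=(TM\cap F)\oplus{}^{\bot}(TM\cap F)$, with projection $\mathrm{P}:T_MP\to TM\cap F$. Adjoint maps are $\mathcal{P}^*(\alpha)=\alpha\circ\mathcal{P}$, $\mathrm{P}^*(\alpha)=\alpha\circ\mathrm{P}$. Define $\mathcal{R}_{H,M}=\mathcal{P}(\mathcal{R}|_M)$, $\Lambda_{H,M}(\alpha,\beta)=\Lambda(\mathcal{P}^*\alpha,\mathcal{P}^*\beta)$, $\overline{\mathcal{R}}_{H,M}=\mathrm{P}(\mathcal{R}|_M)$, $\overline{\Lambda}_{H,M}(\alpha,\beta)=\Lambda(\mathrm{P}^*\alpha,\mathrm{P}^*\beta)$ for $\alpha,\beta\in T_x^*P$, $x\in M$. Both bivectors depend only on the restrictions of $\alpha,\beta$ to $T_xM$, so they are bivector fields on $M$. For $f,g\in C^\infty(M)$, $\{f,g\}_{H,M}=\Lambda_{H,M}(\mathrm{d}f,\mathrm{d}g)-f\,\mathcal{R}_{H,M}(g)+g\,\mathcal{R}_{H,M}(f)$ (nonholonomic bracket) and $\{f,g\}^{\mathrm{P}}_{H,M}=\overline{\Lambda}_{H,M}(\mathrm{d}f,\mathrm{d}g)-f\,\overline{\mathcal{R}}_{H,M}(g)+g\,\overline{\mathcal{R}}_{H,M}(f)$ ($\mathrm{P}$-nonholonomic bracket). *)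

(* Defs.v *)
From HB Require Import structures.
From mathcomp Require Import all_boot all_order all_algebra all_fingroup.
From mathcomp Require Import all_classical all_reals all_analysis.
Set Implicit Arguments.
Unset Strict Implicit.
Unset Printing Implicit Defensive.
Import Order.TTheory GRing.Theory Num.Theory.
Import numFieldNormedType.Exports.
Local Open Scope classical_set_scope.
Local Open Scope ring_scope.

(* [U] is meant to be open; the values of [f] outside [U] are irrelevant. *)
Fixpoint Ck (R : realType) (V W : normedModType R) (k : nat) (U : set V)
    (f : V -> W) : Prop :=
  if k is k'.+1 then
    (forall x, U x -> differentiable f x) /\
    (forall v, Ck k' U (fun x => 'D_v f x))
  else forall x, U x -> {for x, continuous f}.

Definition smooth_on (R : realType) (V W : normedModType R) (U : set V)
    (f : V -> W) : Prop := forall k, Ck k U f.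

(* A homeomorphism from the open set [cdom] of [T] onto the open set
   [cmap @` cdom] of R^d, with inverse [cinv]; [cmap] and [cinv] are total
   functions with arbitrary values outside these sets. *)
Record chart (R : realType) (d : nat) (T : topologicalType) := Chart {
  cdom : set T;
  cmap : T -> 'rV[R]_d;
  cinv : 'rV[R]_d -> T;
  cdom_open : open cdom;
  crange_open : open (cmap @` cdom);
  cmapK : forall x, cdom x -> cinv (cmap x) = x;
  cmap_continuous : forall x, cdom x -> {for x, continuous cmap};
  cinv_continuous : forall z, (cmap @` cdom) z -> {for z, continuous cinv} }.

Definition crange (R : realType) (d : nat) (T : topologicalType)
  (c : chart R d T) : set 'rV[R]_d := cmap c @` cdom c.

(* A smooth structure of dimension [d] on [T], given by an atlas (not
   necessarily maximal) with a preferred chart around each point.  The tangent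
   space at [x] is R^d: a tangent vector is represented by its components in
   the preferred chart at [x]. *)
Record manifold (R : realType) (d : nat) (T : topologicalType) := Manifold {
  atlas : set (chart R d T);
  chart_at : T -> chart R d T;
  chart_at_atlas : forall x, atlas (chart_at x);
  chart_at_dom : forall x, cdom (chart_at x) x;
  chart_compat : forall c c', atlas c -> atlas c' ->
    smooth_on (crange c `&` cinv c @^-1` cdom c') (cmap c' \o cinv c);
  manifold_hausdorff : hausdorff_space T;
  manifold_second_countable : @second_countable T }.

Notation tangent R d := ('rV[R]_d).

Section Manifolds.
Context (R : realType).

(* [f] is smooth on the open set [A]. *)
Definition smooth_fun (d : nat) (T : topologicalType) (S : manifold R d T)
    (W : normedModType R) (A : set T) (f : T -> W) : Prop :=
  forall c, atlas S c -> smooth_on (crange c `&` cinv c @^-1` A) (f \o cinv c).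

Definition smooth_map (d d' : nat) (T T' : topologicalType)
    (S : manifold R d T) (S' : manifold R d' T') (f : T -> T') : Prop :=
  continuous f /\
  forall c c', atlas S c -> atlas S' c' ->
    smooth_on (crange c `&` cinv c @^-1` (f @^-1` cdom c'))
              (cmap c' \o f \o cinv c).

Definition tangent_map (d d' : nat) (T T' : topologicalType)
    (S : manifold R d T) (S' : manifold R d' T') (f : T -> T') (x : T) :
    'Hom(tangent R d, tangent R d') :=
  linfun ('d (cmap (chart_at S' (f x)) \o f \o cinv (chart_at S x))
             (cmap (chart_at S x) x)).

Definition differential (d : nat) (T : topologicalType) (S : manifold R d T)
    (f : T -> R) (x : T) : 'Hom(tangent R d, R^o) :=
  linfun ('d (f \o cinv (chart_at S x) : 'rV[R]_d -> R^o)
             (cmap (chart_at S x) x)).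

(* Components in the chart [c] of the tangent vector [v] at [x]. *)
Definition vector_in (d : nat) (T : topologicalType) (S : manifold R d T)
    (c : chart R d T) (x : T) (v : tangent R d) : 'rV[R]_d :=
  'd (cmap c \o cinv (chart_at S x)) (cmap (chart_at S x) x) v.

(* Tangent vector at [cinv c z] whose components in the chart [c] are [w]. *)
Definition vector_out (d : nat) (T : topologicalType) (S : manifold R d T)
    (c : chart R d T) (z w : 'rV[R]_d) : tangent R d :=
  'd (cmap (chart_at S (cinv c z)) \o cinv c) z w.

End Manifolds.

(* Only used for alternating multilinear maps. *)
Definition kform (R : realType) (V : Type) (k : nat) := ('I_k -> V) -> R.

Definition wedge (R : realType) (V : Type) (k l : nat)
    (a : kform R V k) (b : kform R V l) : kform R V (k + l) :=
  fun v => (k`! * l`!)%:R^-1 *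
    \sum_(s : 'S_(k + l)) (-1) ^+ s *
      (a (fun i => v (s (lshift l i))) * b (fun j => v (s (rshift k j)))).

Definition kform_of1 (R : realType) (V : Type) (a : V -> R) : kform R V 1 :=
  fun v => a (v ord0).

Definition kform_of2 (R : realType) (V : Type) (b : V -> V -> R) :
    kform R V 2 :=
  fun v => b (v ord0) (v ord_max).

(* The type of the successor case is that of a (2 + k'.*2)-form, by
   conversion. *)
Fixpoint wedge_pow2 (R : realType) (V : Type) (b : kform R V 2) (k : nat) :
    kform R V k.*2 :=
  if k is k'.+1 then wedge b (@wedge_pow2 R V b k') else fun=> 1.
Arguments wedge_pow2 {R V} b k _.

Section OneForms.
Context (R : realType) (d : nat) (T : topologicalType) (S : manifold R d T).

(* Evaluation on a vector with constant components [w] of the expression of a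
   1-form in the chart [c]. *)
Definition form_in (eta : T -> 'Hom(tangent R d, R^o)) (c : chart R d T)
    (w z : 'rV[R]_d) : R^o :=
  eta (cinv c z) (vector_out S c z w).

Definition smooth_form (eta : T -> 'Hom(tangent R d, R^o)) : Prop :=
  forall c, atlas S c -> forall w, smooth_on (crange c) (form_in eta c w).

(* d eta (v, w) = v (eta w) - w (eta v), for the extensions of v and w with
   constant components in the preferred chart at x. *)
Definition ext_d (eta : T -> 'Hom(tangent R d, R^o)) (x : T)
    (v w : tangent R d) : R :=
  let c := chart_at S x in
  'D_v (form_in eta c w) (cmap c x) - 'D_w (form_in eta c v) (cmap c x).

End OneForms.

Definition annihilator (R : realType) (V : vectType R) (D : {vspace V}) :
    {vspace 'Hom(V, R^o)} :=
  lker (linfun (fun a : 'Hom(V, R^o) => (a \o projv D)%VF)).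

Lemma annihilatorP (R : realType) (V : vectType R) (D : {vspace V})
    (a : 'Hom(V, R^o)) :
  reflect (forall v, v \in D -> a v = 0) (a \in annihilator D).
Proof.
pose f (b : 'Hom(V, R^o)) : 'Hom(V, R^o) := (b \o projv D)%VF.
have lf : linear f.
  by move=> k b1 b2; rewrite /f comp_lfunDl comp_lfunZl.
pose fL := HB.pack_for {linear 'Hom(V, R^o) -> 'Hom(V, R^o)} f
  (GRing.isLinear.Build _ _ _ _ f lf).
rewrite memv_ker -/f (lfunE fL) /=.
apply: (iffP eqP) => [E v vD|E].
  by rewrite -(projv_id vD) -comp_lfunE -/(f a) E lfunE.
by apply/lfunP => v; rewrite comp_lfunE E ?memv_proj // lfunE.
Qed.

Lemma comp_lfun_restr (R : realType) (V : vectType R) (p : 'End(V))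
    (U : {vspace V}) (c c' : 'Hom(V, R^o)) :
  (forall v, p v \in U) -> (forall v, v \in U -> c v = c' v) ->
  (c \o p)%VF = (c' \o p)%VF.
Proof. by move=> pU cc'; apply/lfunP => v; rewrite !comp_lfunE; apply: cc'. Qed.

Record contact_form (R : realType) (n : nat) (P : topologicalType)
    (S : manifold R n.*2.+1 P) := ContactForm {
  eta :> P -> 'Hom(tangent R n.*2.+1, R^o);
  eta_smooth : smooth_form S eta;
  eta_contact : forall x, exists v : 'I_(1 + n.*2) -> tangent R n.*2.+1,
    wedge (kform_of1 (eta x)) (wedge_pow2 (kform_of2 (ext_d S eta x)) n) v
      != 0 }.

Section Contact.
Context (R : realType) (n : nat) (P : topologicalType).
Context (S : manifold R n.*2.+1 P) (eta : contact_form S).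

Definition flat (x : P) :
    'Hom(tangent R n.*2.+1, 'Hom(tangent R n.*2.+1, R^o)) :=
  linfun (fun v => linfun (ext_d S eta x v : tangent R n.*2.+1 -> R^o)
                   + eta x v *: eta x).

Definition sharp (x : P) :
    'Hom('Hom(tangent R n.*2.+1, R^o), tangent R n.*2.+1) :=
  (flat x)^-1%VF.

Definition reeb (x : P) : tangent R n.*2.+1 :=
  xget 0 [set v | (forall w, ext_d S eta x v w = 0) /\ eta x v = 1].

Definition jacobi (x : P) (a b : 'Hom(tangent R n.*2.+1, R^o)) : R :=
  - ext_d S eta x (sharp x a) (sharp x b).

Definition lperp (x : P) (D : {vspace tangent R n.*2.+1}) :
    {vspace tangent R n.*2.+1} :=
  (sharp x @: annihilator D)%VS.

End Contact.

(* [M] carries the subspace topology (that of [set_type M]), so a smooth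
   structure on it for which the inclusion is an immersion makes it an embedded
   submanifold. *)
Definition embedded_submanifold (R : realType) (d m : nat)
    (P : topologicalType) (SP : manifold R d P) (M : set P)
    (SM : manifold R m M) : Prop :=
  smooth_map SM SP (set_val : M -> P) /\
  forall x : M, lker (tangent_map SM SP (set_val : M -> P) x) = 0%VS.

(* [F x] is a subspace of the tangent space of [P] at [x]; the subbundle has
   rank [r] and is spanned around each point by a smooth local frame. *)
Definition vector_subbundle (R : realType) (d m r : nat)
    (P : topologicalType) (SP : manifold R d P) (M : set P)
    (SM : manifold R m M) (F : M -> {vspace tangent R d}) : Prop :=
  forall x0 : M, exists U : set M, exists s : 'I_r -> M -> tangent R d,
    [/\ open U, U x0,
        forall i (c : chart R d P), atlas SP c ->
          smooth_fun SM (U `&` [set x | cdom c (set_val x)])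
            (fun x => vector_in SP c (set_val x) (s i x))
      & forall x, U x -> basis_of (F x) [seq s i x | i : 'I_r] ].

Record constrained_system (R : realType) (n m r : nat) := ConstrainedSystem {
  cs_P : topologicalType;
  cs_SP : manifold R n.*2.+1 cs_P;
  cs_eta : contact_form cs_SP;
  cs_H : cs_P -> R;
  cs_H_smooth : smooth_fun cs_SP setT (cs_H : cs_P -> R^o);
  cs_M : set cs_P;
  cs_SM : manifold R m cs_M;
  cs_M_submanifold : embedded_submanifold cs_SP cs_SM;
  cs_F : cs_M -> {vspace tangent R n.*2.+1};
  cs_F_subbundle : vector_subbundle r cs_SP cs_SM cs_F }.
Arguments cs_H {R n m r} c _.
Arguments cs_M {R n m r} c _.
Arguments cs_F {R n m r} c _.

Section Brackets.
Context (R : realType) (n m r : nat) (C : constrained_system R n m r).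
Local Notation P := (cs_P C).
Local Notation M := (cs_M C).
Local Notation TP := (tangent R n.*2.+1).
Local Notation eta := (cs_eta C).
Local Notation incl := (set_val : M -> P).

Definition dincl (x : M) : 'Hom(tangent R m, TP) :=
  tangent_map (cs_SM C) (cs_SP C) incl x.

Definition TM (x : M) : {vspace TP} := limg (dincl x).

Definition Fperp (x : M) : {vspace TP} := lperp eta (incl x) (cs_F C x).

Definition TMF (x : M) : {vspace TP} := (TM x :&: cs_F C x)%VS.

(* [daddv_pi U V] is the projection onto [U] along [V] when the ambient space
   is the direct sum of [U] and [V]. *)
Definition proj_nh (x : M) : 'End(TP) := daddv_pi (TM x) (Fperp x).

Definition proj_P (x : M) : 'End(TP) :=
  daddv_pi (TMF x) (lperp eta (incl x) (TMF x)).

Definition reeb_HM (x : M) : TP := proj_nh x (reeb eta (incl x)).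

Definition Lambda_HM (x : M) (a b : 'Hom(TP, R^o)) : R :=
  jacobi eta (incl x) (a \o proj_nh x)%VF (b \o proj_nh x)%VF.

Definition reeb_bar_HM (x : M) : TP := proj_P x (reeb eta (incl x)).

Definition Lambda_bar_HM (x : M) (a b : 'Hom(TP, R^o)) : R :=
  jacobi eta (incl x) (a \o proj_P x)%VF (b \o proj_P x)%VF.

(* A covector on TP restricting to df on TM: [(dincl x)^-1] is a left inverse
   of the injective map [dincl x]. *)
Definition dM (f : M -> R) (x : M) : 'Hom(TP, R^o) :=
  (differential (cs_SM C) f x \o (dincl x)^-1)%VF.

Lemma dM_restr (f : M -> R) (x : M) :
  (dM f x \o dincl x)%VF = differential (cs_SM C) f x.
Proof.
have [_ inj] := cs_M_submanifold C.
apply/lfunP => v; rewrite !comp_lfunE lker0_lfunK //; exact/eqP/inj.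
Qed.

Lemma Lambda_HM_restr (x : M) (a a' b b' : 'Hom(TP, R^o)) :
  (forall v, v \in TM x -> a v = a' v) ->
  (forall v, v \in TM x -> b v = b' v) ->
  Lambda_HM x a b = Lambda_HM x a' b'.
Proof.
have inTM v : proj_nh x v \in TM x by rewrite /proj_nh; apply: memv_pi.
move=> aa' bb'; have ea := comp_lfun_restr inTM aa'.
by have eb := comp_lfun_restr inTM bb'; rewrite /Lambda_HM ea eb.
Qed.

Lemma Lambda_bar_HM_restr (x : M) (a a' b b' : 'Hom(TP, R^o)) :
  (forall v, v \in TM x -> a v = a' v) ->
  (forall v, v \in TM x -> b v = b' v) ->
  Lambda_bar_HM x a b = Lambda_bar_HM x a' b'.
Proof.
have inTM v : proj_P x v \in TM x by
  apply: (subvP (capvSl (TM x) (cs_F C x))); apply: memv_pi.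
move=> aa' bb'; have ea := comp_lfun_restr inTM aa'.
by have eb := comp_lfun_restr inTM bb'; rewrite /Lambda_bar_HM ea eb.
Qed.

Definition nh_bracket (f g : M -> R) (x : M) : R :=
  Lambda_HM x (dM f x) (dM g x)
  - f x * dM g x (reeb_HM x) + g x * dM f x (reeb_HM x).

Definition P_nh_bracket (f g : M -> R) (x : M) : R :=
  Lambda_bar_HM x (dM f x) (dM g x)
  - f x * dM g x (reeb_bar_HM x) + g x * dM f x (reeb_bar_HM x).

Definition mechanical_condition : Prop :=
  forall x : M,
    differential (cs_SP C) (cs_H C) (incl x) \in annihilator (Fperp x).

End Brackets.

(* Main.v *)
Require Import Defs.
From HB Require Import structures.
From mathcomp Require Import all_boot all_order all_algebra all_fingroup.
From mathcomp Require Import all_classical all_reals all_analysis.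
Set Implicit Arguments.
Unset Strict Implicit.
Unset Printing Implicit Defensive.
Import Order.TTheory GRing.Theory Num.Theory.
Import numFieldNormedType.Exports.
Local Open Scope ring_scope.

(** The equality is pointwise linear algebra in V = T_x P, with the form
    B (v, w) = d eta (v, w) + eta (v) eta (w) given by [flat].

    Two facts come from geometry.  The form d eta is bilinear, because the
    coordinate expressions of eta are differentiable.  And B is nondegenerate:
    a vector v with B (v, -) = 0 satisfies eta (v) ^ 2 = B (v, v) = 0, hence is
    annihilated by eta and by d eta, hence by the alternating form
    eta /\ (d eta) ^ n, whose degree is dim V; such a form has a nonzero
    annihilated vector only if it is zero, against the contact condition.
    Since dim V is odd, d eta has a kernel, which gives the Reeb vector R.

    Write F' = lperp F, TF = T :&: F and TF' = lperp TF.  Since R lies in F,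
    eta (v) = B (v, R) = 0 for v in F', so F' lies in the radical of d eta
    restricted to F ([deta_Fperp]).  Counting dimensions,
    with rank F = dim T, gives T + F' = V,
    TF + F' = F and lperp F' = F; moreover TF and TF' meet only in 0, and
    F' <= TF'.  So the two projections, onto T along F' and onto TF along
    TF', coincide on F = TF + F' ([proj_eq_on_F]); as R lies in F, the two
    projected Reeb vectors are equal.

    For the bivectors, let u and u' be the images under [sharp] of the
    pullbacks of a covector by the two projections.  Both pullbacks vanish on
    F', so u and u' lie in lperp F' = F; they agree on F, so u - u' lies in F'
    ([sharp_sub]), hence in the radical of d eta on F.  Therefore d eta takes
    the same value on the two pairs of vectors ([jacobi_proj_eq]). *)

Definition linear_of (F : pzRingType) (V W : lmodType F) (f : V -> W)
    (lf : linear f) : {linear V -> W} :=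
  HB.pack_for {linear V -> W} f (GRing.isLinear.Build _ _ _ _ f lf).

Definition scalar_of (F : pzRingType) (V : lmodType F) (f : V -> F)
    (lf : scalar f) : {scalar V} :=
  HB.pack_for {scalar V} f (GRing.isLinear.Build _ _ _ _ f lf).

(** * Exterior forms *)

Section ExteriorForms.
Context (R : realType) (V : lmodType R).

Definition set_slot k (v : 'I_k -> V) (j : 'I_k) (w : V) : 'I_k -> V :=
  fun i => if i == j then w else v i.

Definition multilinear k (a : kform R V k) : Prop :=
  forall v j, scalar (fun w => a (set_slot v j w)).

(** All slots are tested, rather than the first one, because [a] may be a factor
    of an exterior product not yet known to be alternating. *)
Definition annihilated_by k (a : kform R V k) (u : V) : Prop :=
  forall v j, v j = u -> a v = 0.

Definition alternating k (a : kform R V k) : Prop :=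
  forall v i j, i != j -> v i = v j -> a v = 0.

Lemma set_slot_comp k l (h : 'I_l -> 'I_k) (v : 'I_k -> V) (j : 'I_l) w :
  injective h ->
  (fun i => set_slot v (h j) w (h i)) = set_slot (fun i => v (h i)) j w.
Proof. by move=> hI; apply/funext => i; rewrite /set_slot (inj_eq hI). Qed.

Lemma set_slot_notin k l (h : 'I_l -> 'I_k) (v : 'I_k -> V) (j : 'I_k) w :
  (forall i, h i != j) ->
  (fun i => set_slot v j w (h i)) = (fun i => v (h i)).
Proof. by move=> hj; apply/funext => i; rewrite /set_slot (negPf (hj i)). Qed.

Lemma multilinear_of1 (a : V -> R) : scalar a -> multilinear (kform_of1 a).
Proof.
move=> la v j c w1 w2; rewrite /kform_of1 /set_slot (ord1 j) /=; exact: la.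
Qed.

Lemma multilinear_of2 (b : V -> V -> R) :
  (forall w, scalar (b w)) -> (forall w, scalar (b^~ w)) ->
  multilinear (kform_of2 b).
Proof.
move=> lr ll v j c w1 w2; rewrite /kform_of2 /set_slot.
by case: j => [[|[|]]] //= ltj; [apply: ll | apply: lr].
Qed.

Lemma perm_slotP k l (s : 'S_(k + l)) (j : 'I_(k + l)) :
  (exists i, j = s (lshift l i)) \/ (exists i, j = s (rshift k i)).
Proof.
rewrite -(permKV s j); set j' := (s^-1)%g j.
rewrite -(splitK j'); case: (fintype.split j') => i /=; [left|right];
  by exists i.
Qed.

(** In each term of the antisymmetrized product a given slot is an argument of
    exactly one of the two factors. *)
Lemma multilinear_wedge k l (a : kform R V k) (b : kform R V l) :
  multilinear a -> multilinear b -> multilinear (wedge a b).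
Proof.
move=> la lb v j c w1 w2; rewrite /wedge mulrCA -mulrDr; congr (_ * _).
rewrite mulr_sumr -big_split; apply: eq_bigr => s _ /=.
have sl : injective (fun i => s (lshift l i)).
  by move=> x y /perm_inj /lshift_inj.
have sr : injective (fun i => s (rshift k i)).
  by move=> x y /perm_inj /rshift_inj.
case: (perm_slotP s j) => -[i ->].
  have nj i' : s (rshift k i') != s (lshift l i).
    by rewrite (inj_eq perm_inj) eq_rlshift.
  rewrite !(set_slot_comp v i _ sl) !(set_slot_notin v _ nj) (la _ i) /=.
  by rewrite mulrDl mulrDr -mulrA mulrCA.
have nj i' : s (lshift l i') != s (rshift k i).
  by rewrite (inj_eq perm_inj) eq_lrshift.
rewrite !(set_slot_comp v i _ sr) !(set_slot_notin v _ nj) (lb _ i) /=.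
by rewrite !mulrDr !(mulrCA _ c).
Qed.

Lemma annihilated_wedge k l (a : kform R V k) (b : kform R V l) u :
  annihilated_by a u -> annihilated_by b u -> annihilated_by (wedge a b) u.
Proof.
move=> au bu v j vj; rewrite /wedge big1 ?mulr0 // => s _.
case: (perm_slotP s j) => -[i ji].
  by rewrite (au _ i) ?mul0r ?mulr0 // -ji.
by rewrite (bu _ i) ?mulr0 // -ji.
Qed.

(** Reindexing the sum by the transposition of the two equal arguments changes
    the sign of each term. *)
Lemma alternating_wedge k l (a : kform R V k) (b : kform R V l) :
  alternating (wedge a b).
Proof.
move=> v i j ij vij.
have vt m : v (tperm i j m) = v m by case: tpermP => [->|->|].
suff : wedge a b v = - wedge a b v.
  by move/eqP; rewrite -addr_eq0 -mulr2n mulrn_eq0 => /= /eqP.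
rewrite {1}/wedge -mulrN -sumrN; congr (_ * _).
rewrite (reindex_inj (mulIg (tperm i j))) /=; apply: eq_bigr => s _.
rewrite odd_permM odd_tperm ij addbT signrN mulNr.
congr (- (_ * (a _ * b _))); apply/funext => m; by rewrite permM vt.
Qed.

Lemma multilinear_wedge_pow2 (b : kform R V 2) k :
  multilinear b -> multilinear (wedge_pow2 b k).
Proof.
move=> lb; elim: k => [v []//|k IHk].
exact: (multilinear_wedge lb IHk).
Qed.

Lemma annihilated_wedge_pow2 (b : kform R V 2) k u :
  annihilated_by b u -> annihilated_by (wedge_pow2 b k) u.
Proof.
move=> bu; elim: k => [v []//|k IHk].
exact: (annihilated_wedge bu IHk).
Qed.

End ExteriorForms.

(** Among [v] and [u] there is a linear relation: some nonzero combination of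
    the [v i] is 0 or [u], hence is sent to 0 when put in any slot.  In a slot
    [j] where its coefficient [c j] is nonzero, the same value is
    [c j * a v], since [a] is alternating. *)
Lemma top_form_annihilated (R : realType) N (a : kform R 'rV[R]_N N) u :
  multilinear a -> alternating a -> annihilated_by a u -> u != 0 ->
  forall v, a v = 0.
Proof.
move=> la aa au u0 v; pose A : 'M[R]_N := \matrix_i v i.
have [c c0 cA] : exists2 c : 'rV[R]_N, c != 0 & c *m A = 0 \/ c *m A = u.
  have [/det0P[c c0 cA]|dA] := boolP (\det A == 0); first by exists c; auto.
  have uA : A \in unitmx by rewrite unitmxE unitfE.
  exists (u *m invmx A); last by rewrite mulmxKV //; right.
  by apply: contraNneq u0 => uA0; rewrite -(mulmxKV uA u) uA0 mul0mx.
have [j cj] : exists j, c 0 j != 0 by apply/rV0Pn.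
pose fL := scalar_of (la v j).
have fLE i : fL (c 0 i *: row i A) = c 0 i * a (set_slot v j (v i)).
  by rewrite linearZ rowK.
have E : fL (c *m A) = c 0 j * a v.
  rewrite mulmx_sum_row linear_sum (bigD1 j) // big1 => [|i ij].
    rewrite fLE [LHS]addr0; congr (_ * a _); apply/funext => i.
    by rewrite /set_slot; case: eqP => [->|].
  by rewrite fLE (aa _ i j) ?mulr0 // /set_slot (negPf ij) eqxx.
have F0 : fL (c *m A) = 0.
  case: cA => ->; first exact: linear0.
  by apply: (au _ j); rewrite /set_slot eqxx.
by move: E; rewrite F0 => /esym/eqP; rewrite mulf_eq0 (negPf cj) => /eqP.
Qed.

(** The matrix A of a skew form satisfies det A = det A^T = (-1)^N det A. *)
Lemma skew_odd_kernel (R : realType) N (b : 'rV[R]_N -> 'rV[R]_N -> R) :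
  (forall w, scalar (b w)) -> (forall w, scalar (b^~ w)) ->
  (forall v w, b v w = - b w v) -> odd N ->
  exists2 v, v != 0 & forall w, b v w = 0.
Proof.
move=> lr ll skew oN; pose A := \matrix_(i, j) b (delta_mx 0 i) (delta_mx 0 j).
have /det0P[v v0 vA] : \det A == 0.
  suff : \det A = - \det A.
    by move/eqP; rewrite -addr_eq0 -mulr2n mulrn_eq0 /=.
  have AT : A^T = - A by apply/matrixP => i j; rewrite !mxE skew.
  by rewrite -{1}det_tr AT -scaleN1r detZ -signr_odd oN mulN1r.
exists v => // w.
pose bl w := scalar_of (ll w).
pose br w := scalar_of (lr w).
have v_delta j : b v (delta_mx 0 j) = 0.
  have /matrixP/(_ 0 j) := vA; rewrite !mxE => <-.
  rewrite -[LHS]/(bl _ v) [X in bl _ X]row_sum_delta linear_sum.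
  by apply: eq_bigr => i _; rewrite linearZ mxE.
rewrite -[LHS]/(br v w) [w]row_sum_delta linear_sum big1 // => j _.
by rewrite linearZ [br _ _]v_delta [LHS]mulr0.
Qed.

(** * Pairings and projections *)

Section Pairing.
Context (F : fieldType) (V W : vectType F).

(** Pairing with a basis of [D] is a linear map injective on [A]. *)
Lemma dim_pairing (b : V -> W -> F) (A : {vspace V}) (D : {vspace W}) :
  (forall w, scalar (b^~ w)) -> (forall v, scalar (b v)) ->
  (forall v, v \in A -> (forall w, w \in D -> b v w = 0) -> v = 0) ->
  (\dim A <= \dim D)%N.
Proof.
move=> ll lr nd; pose X := vbasis D.
pose f v : 'rV[F]_(\dim D) := \row_i b v X`_i.
have lf : linear f by move=> c v w; apply/rowP => i; rewrite !mxE ll.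
pose fL := linear_of lf.
have /limg_dim_eq <- : (A :&: lker (linfun fL) = 0)%VS.
  apply/eqP; rewrite -subv0; apply/subvP => v.
  rewrite memv_cap memv_ker lfunE memv0 => /andP[vA /eqP /rowP fv].
  apply/eqP/(nd _ vA) => w wD.
  pose br := scalar_of (lr v).
  rewrite -[LHS]/(br w) (coord_vbasis wD) linear_sum big1 // => i _.
  by rewrite linearZ; have := fv i; rewrite !mxE => /= ->; rewrite mulr0.
by apply: leq_trans (dimvS (subvf _)) _; rewrite dimvf /dim /= mul1n.
Qed.

End Pairing.

Lemma daddv_pi0 (K : fieldType) (vT : vectType K) (U W : {vspace vT}) w :
  (U :&: W = 0)%VS -> w \in W -> daddv_pi U W w = 0.
Proof.
move=> UW wW; have wUW : w \in (U + W)%VS by rewrite -[w]add0r memv_add ?mem0v.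
have := daddv_pi_add UW wUW.
by rewrite (@daddv_pi_id _ _ W U) 1?capvC // -{3}[w]add0r => /addIr.
Qed.

(** * Bilinearity of the exterior derivative *)

Section ExteriorDerivative.
Context (R : realType) (d : nat) (T : topologicalType) (S : manifold R d T).
Variable eta : T -> 'Hom(tangent R d, R^o).
Hypothesis eta_smooth : smooth_form S eta.

Lemma form_in_linear (c : chart R d T) k w1 w2 :
  form_in S eta c (k *: w1 + w2) =
  (k \*: form_in S eta c w1) + form_in S eta c w2.
Proof.
apply/funext => z.
have vP : vector_out S c z (k *: w1 + w2) =
    k *: vector_out S c z w1 + vector_out S c z w2 by exact: linearP.
rewrite {1}/form_in vP.
exact: (linearP (eta (cinv c z))).
Qed.

Lemma form_in_differentiable x w :
  differentiable (form_in S eta (chart_at S x) w) (cmap (chart_at S x) x).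
Proof.
apply: (eta_smooth (chart_at_atlas S x) w 1%N).1.
by exists x => //; apply: chart_at_dom.
Qed.

Lemma ext_d_skew x v w : ext_d S eta x v w = - ext_d S eta x w v.
Proof. by rewrite /ext_d opprB. Qed.

(** Smoothness enters here: a directional derivative is linear in the direction
    only for a differentiable function. *)
Lemma ext_d_linearl x w : scalar ((ext_d S eta x)^~ w).
Proof.
move=> k v1 v2; rewrite /ext_d form_in_linear.
have df u := form_in_differentiable x u.
have dv u v : derivable (form_in S eta (chart_at S x) u)
    (cmap (chart_at S x) x) v by exact: diff_derivable.
rewrite deriveD ?deriveZ //; last exact: derivableZ.
rewrite !(deriveE _ (df w)) linearP /=.
by rewrite mulrBr opprD addrACA.
Qed.

Lemma ext_d_linearr x v : scalar (ext_d S eta x v).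
Proof.
by move=> k w1 w2; rewrite ext_d_skew ext_d_linearl opprD -mulrN -!ext_d_skew.
Qed.

End ExteriorDerivative.

(** * The tangent space of a contact manifold *)

Section ContactSpace.
Context (R : realType) (n : nat) (P : topologicalType).
Context (S : manifold R n.*2.+1 P) (eta : contact_form S) (x : P).
Local Notation V := (tangent R n.*2.+1).
Local Notation deta := (ext_d S eta x).
Implicit Types (u v w : V) (D : {vspace V}).

Let deta_linearl w : scalar (deta^~ w).
Proof. exact: ext_d_linearl (@eta_smooth _ _ _ _ eta) x w. Qed.

Let deta_linearr v : scalar (deta v).
Proof. exact: ext_d_linearr (@eta_smooth _ _ _ _ eta) x v. Qed.

Lemma flatE v w : flat eta x v w = deta v w + eta x v * eta x w.
Proof.
pose dv v' := linear_of (deta_linearr v').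
have dvE v' w' : linfun (deta v' : V -> R^o) w' = deta v' w'.
  exact: (lfunE (dv v')).
pose f v' : 'Hom(V, R^o) := linfun (deta v' : V -> R^o) + eta x v' *: eta x.
have lf : linear f.
  move=> k v1 v2; apply/lfunP => w'.
  rewrite /f !(add_lfunE, scale_lfunE) !dvE deta_linearl linearP.
  by rewrite scalerDl scalerDr /= scalerA addrACA.
pose fL := linear_of lf.
by rewrite /flat (lfunE fL) /= /f add_lfunE scale_lfunE dvE.
Qed.

Lemma deta_alternating v : deta v v = 0.
Proof.
apply/eqP; rewrite -[_ == 0](mulrn_eq0 _ 2) mulr2n addr_eq0.
by rewrite -ext_d_skew.
Qed.

Lemma flat_diag_eq0 v : flat eta x v v = 0 -> eta x v = 0.
Proof.
by rewrite flatE deta_alternating add0r => /eqP; rewrite mulf_eq0 orbb => /eqP.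
Qed.

(** A nonzero vector in the kernel would be annihilated by eta and by d eta,
    hence by the volume form. *)
Lemma flat_inj v : (forall w, flat eta x v w = 0) -> v = 0.
Proof.
move=> fv; have ev := flat_diag_eq0 (fv v).
have dv w : deta v w = 0 by have := fv w; rewrite flatE ev mul0r addr0.
apply/eqP; apply: contraT => v0.
have [u /eqP[]] := @eta_contact _ _ _ _ eta x.
have m2 := multilinear_of2 deta_linearr deta_linearl.
have m1 : multilinear (kform_of1 (eta x : V -> R)).
  by apply: multilinear_of1 => k w1 w2; rewrite linearP.
have a2 : annihilated_by (kform_of2 deta) v.
  move=> y [[|[|]]] //= ltj yv; rewrite /kform_of2.
    by rewrite (_ : ord0 = Ordinal ltj) ?yv ?dv //; apply: val_inj.
  rewrite (_ : ord_max = Ordinal ltj) ?yv; last exact: val_inj.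
  by rewrite ext_d_skew dv oppr0.
have a1 : annihilated_by (kform_of1 (eta x : V -> R)) v.
  by move=> y j; rewrite (ord1 j) /kform_of1 => ->.
pose a := wedge (kform_of1 (eta x : V -> R)) (wedge_pow2 (kform_of2 deta) n).
have am : multilinear a.
  exact: multilinear_wedge m1 (multilinear_wedge_pow2 m2).
have aa : alternating a by apply: alternating_wedge.
have av : annihilated_by a v.
  exact: annihilated_wedge a1 (annihilated_wedge_pow2 a2).
exact: (@top_form_annihilated R n.*2.+1 a v am aa av v0 u).
Qed.

Lemma flat_sharp a : flat eta x (sharp eta x a) = a.
Proof.
rewrite /sharp limg_lfunVK //.
suff -> : limg (flat eta x) = fullv by rewrite memvf.
apply/eqP; rewrite eqEdim subvf limg_dim_eq.
  by rewrite !dimvf /dim /= muln1.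
apply/eqP; rewrite capfv -subv0; apply/subvP => v.
rewrite memv_ker memv0 => /eqP fv.
by apply/eqP/flat_inj => w; rewrite fv lfunE.
Qed.

Lemma sharp_flat v : sharp eta x (flat eta x v) = v.
Proof.
apply/subr0_eq/flat_inj => w.
by rewrite linearB /= flat_sharp subrr lfunE.
Qed.

Lemma lperpP D v :
  reflect (forall w, w \in D -> flat eta x v w = 0) (v \in lperp eta x D).
Proof.
apply: (iffP idP) => [/memv_imgP[a /annihilatorP aD ->] w|fv].
  by rewrite flat_sharp; apply: aD.
by rewrite -(sharp_flat v) memv_img //; apply/annihilatorP.
Qed.

(** [flat] pairs [D] with a complement of [lperp D] without kernel on either
    side, so these two spaces have the same dimension by [dim_pairing]. *)
Lemma dim_lperp D : (\dim (lperp eta x D) + \dim D)%N = n.*2.+1.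
Proof.
set L := lperp eta x D.
have dL : (\dim L^C + \dim L)%N = n.*2.+1.
  rewrite dimv_compl subnK ?dimvS ?subvf //.
  by rewrite dimvf /dim /= mul1n.
suff -> : \dim D = \dim L^C by rewrite addnC.
have ll w : scalar ((flat eta x)^~ w).
  by move=> k v1 v2; rewrite linearP add_lfunE scale_lfunE.
have lr v : scalar (flat eta x v) by move=> k w1 w2; rewrite linearP.
apply/eqP; rewrite eqn_leq; apply/andP; split.
  apply: (@dim_pairing _ _ _ (fun v w => flat eta x w v)) => // v vD fv.
  have fv0 w : flat eta x w v = 0.
    have : w \in (L + L^C)%VS by rewrite addv_complf memvf.
    case/memv_addP => a /lperpP aL [b bL ->].
    by rewrite linearD add_lfunE aL // fv // addr0.
  (* [flat] is not symmetric, but a vector v in its right kernel satisfies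
     eta (v) = 0, which makes it lie in the left kernel. *)
  have ev := flat_diag_eq0 (fv0 v).
  apply: flat_inj => w; have := fv0 w.
  rewrite !flatE ev mulr0 mul0r !addr0 ext_d_skew => /eqP.
  by rewrite oppr_eq0 => /eqP.
apply: (@dim_pairing _ _ _ (fun v w => flat eta x v w)) => // v vL fv.
apply/eqP; rewrite -memv0 -(capv_compl L) memv_cap vL andbT.
exact/lperpP.
Qed.

(** A nonzero kernel vector of d eta, which exists because the dimension is odd,
    is not in the kernel of eta since [flat] is injective; rescale it. *)
Lemma reebP : (forall w, deta (reeb eta x) w = 0) /\ eta x (reeb eta x) = 1.
Proof.
suff ex : exists v, (forall w, deta v w = 0) /\ eta x v = 1.
  exact: (xgetPex 0 ex).
have [|v v0 dv] := skew_odd_kernel deta_linearr deta_linearl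
    (@ext_d_skew _ _ _ S eta x).
  by rewrite /= odd_double.
have ev : eta x v != 0.
  apply: contraNneq v0 => ev; apply/eqP/flat_inj => w.
  by rewrite flatE dv ev mul0r addr0.
exists ((eta x v)^-1 *: v); split=> [w|]; last by rewrite linearZ [LHS]mulVf.
rewrite -[LHS]/(scalar_of (deta_linearl w) _) linearZ.
exact: etrans (congr1 (fun r => _ * r) (dv w)) (mulr0 _).
Qed.

Lemma flat_reebr v : flat eta x v (reeb eta x) = eta x v.
Proof.
by have [dR eR] := reebP; rewrite flatE ext_d_skew dR oppr0 add0r eR mulr1.
Qed.

End ContactSpace.

(** * The two projections and their bivectors *)

Section Projections.
Context (R : realType) (n : nat) (P : topologicalType).
Context (S : manifold R n.*2.+1 P) (eta : contact_form S) (x : P).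
Local Notation V := (tangent R n.*2.+1).
Variables (T F : {vspace V}).
Local Notation Fp := (lperp eta x F).
Local Notation TF := (T :&: F)%VS.
Hypotheses (reebF : reeb eta x \in F) (FpF : (Fp <= F)%VS)
  (FpT : (Fp :&: T = 0)%VS) (dimTF : \dim F = \dim T).

Lemma eta_Fperp v : v \in Fp -> eta x v = 0.
Proof. by move=> /lperpP vF; rewrite -flat_reebr vF. Qed.

Lemma deta_Fperp v w : v \in Fp -> w \in F -> ext_d S eta x v w = 0.
Proof.
move=> vF wF; have /lperpP/(_ _ wF) := vF.
by rewrite flatE (eta_Fperp vF) mul0r addr0.
Qed.

(** [lperp] is not an involution in general, since [flat] is not symmetric; here
    F <= lperp (lperp F) because both terms of B (v, w) vanish for v in F and w
    in lperp F, and the dimensions agree. *)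
Lemma lperp_Fperp : lperp eta x Fp = F.
Proof.
apply/esym/eqP; rewrite eqEdim; apply/andP; split.
  apply/subvP => v vF; apply/lperpP => w wF.
  rewrite flatE ext_d_skew (deta_Fperp wF vF) (eta_Fperp wF).
  by rewrite mulr0 oppr0 addr0.
rewrite -(leq_add2r (\dim Fp)) dim_lperp addnC.
by rewrite dim_lperp.
Qed.

Lemma Fperp_compl : (T + Fp)%VS = fullv.
Proof.
apply/eqP; rewrite eqEdim subvf dimv_disjoint_sum ?(capvC T) //.
by rewrite -dimTF addnC dim_lperp dimvf /dim /= mul1n.
Qed.

Lemma F_split : (TF + Fp)%VS = F.
Proof. by rewrite capvC vspace_modr // Fperp_compl capvf. Qed.

Lemma Fperp_TFperp : (Fp <= lperp eta x TF)%VS.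
Proof.
apply/subvP => v /lperpP vF; apply/lperpP => w.
by rewrite memv_cap => /andP[_ /vF].
Qed.

(** A vector of TF orthogonal to TF is also orthogonal to lperp F, by
    [lperp_Fperp], hence to F; so it lies in lperp F and in T. *)
Lemma TF_cap : (TF :&: lperp eta x TF = 0)%VS.
Proof.
apply/eqP; rewrite -subv0 -FpT; apply/subvP => v.
rewrite !memv_cap => /andP[/andP[vT vF] /lperpP vp]; rewrite vT andbT.
apply/lperpP => w; rewrite -F_split => /memv_addP[a aT [b bF ->]].
have vb : flat eta x v b = 0.
  by move: vF; rewrite -lperp_Fperp => /lperpP; apply.
by rewrite linearD /= vp // vb addr0.
Qed.

Local Notation pT := (daddv_pi T Fp).
Local Notation pTF := (daddv_pi TF (lperp eta x TF)).

(** On F = TF + lperp F both are the projection onto TF along lperp F. *)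
Lemma proj_eq_on_F v : v \in F -> pT v = pTF v.
Proof.
have TFp : (T :&: Fp = 0)%VS by rewrite capvC.
rewrite -{1}F_split => /memv_addP[a aT [b bF ->]]; rewrite !linearD /=.
have bTF := subvP Fperp_TFperp _ bF.
rewrite [daddv_pi T _ b](daddv_pi0 TFp) // [pTF b](daddv_pi0 TF_cap) //.
rewrite (daddv_pi_id TF_cap) // daddv_pi_id //.
by move: aT; rewrite memv_cap => /andP[].
Qed.

(** The pullback of [a] vanishes on lperp F, so its image under [sharp] lies in
    lperp (lperp F) = F. *)
Lemma sharp_pT a : sharp eta x (a \o pT)%VF \in F.
Proof.
suff: sharp eta x (a \o pT)%VF \in lperp eta x Fp by rewrite lperp_Fperp.
apply/lperpP => w wF.
have TFp : (T :&: Fp = 0)%VS by rewrite capvC.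
by rewrite flat_sharp comp_lfunE (daddv_pi0 TFp) // linear0.
Qed.

Lemma sharp_pTF a : sharp eta x (a \o pTF)%VF \in F.
Proof.
suff: sharp eta x (a \o pTF)%VF \in lperp eta x Fp by rewrite lperp_Fperp.
apply/lperpP => w wF.
rewrite flat_sharp comp_lfunE (daddv_pi0 TF_cap) ?linear0 //.
exact: (subvP Fperp_TFperp).
Qed.

(** The two pullbacks of [a] agree on F, where the projections do. *)
Lemma sharp_sub a :
  sharp eta x (a \o pT)%VF - sharp eta x (a \o pTF)%VF \in Fp.
Proof.
apply/lperpP => w wF.
rewrite linearB /= !flat_sharp add_lfunE opp_lfunE !comp_lfunE.
by rewrite proj_eq_on_F // subrr.
Qed.

(** The arguments lie in F and differ by elements of lperp F, which are in the
    radical of the restriction of d eta to F. *)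
Lemma jacobi_proj_eq a b :
  jacobi eta x (a \o pT)%VF (b \o pT)%VF =
  jacobi eta x (a \o pTF)%VF (b \o pTF)%VF.
Proof.
rewrite /jacobi; congr (- _).
have lB v w u : ext_d S eta x (v - w) u = ext_d S eta x v u - ext_d S eta x w u.
  rewrite -[v - w]addrC -scaleN1r (ext_d_linearl (@eta_smooth _ _ _ _ eta)).
  by rewrite mulN1r addrC.
have E c v : v \in F ->
    ext_d S eta x (sharp eta x (c \o pT)%VF) v =
    ext_d S eta x (sharp eta x (c \o pTF)%VF) v.
  by move=> vF; apply/subr0_eq; rewrite -lB deta_Fperp ?sharp_sub.
by rewrite (E a _ (sharp_pT b)) ext_d_skew (E b _ (sharp_pTF a)) -ext_d_skew.
Qed.

End Projections.

Theorem theorem10 (R : realType) (n m r : nat)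
    (C : constrained_system R n m r)
    (hmech : mechanical_condition C)
    (hreeb : forall x : cs_M C, reeb (cs_eta C) (set_val x) \in cs_F C x)
    (hFperp : forall x : cs_M C, (Fperp x <= cs_F C x)%VS)
    (htrans : forall x : cs_M C, (Fperp x :&: TM x = 0)%VS)
    (hrank : r = m)
    (f g : cs_M C -> R)
    (hf : smooth_fun (cs_SM C) setT (f : cs_M C -> R^o))
    (hg : smooth_fun (cs_SM C) setT (g : cs_M C -> R^o)) :
  nh_bracket f g = P_nh_bracket f g.
Proof.
apply/funext => x.
have dimFT : \dim (cs_F C x) = \dim (TM x).
  have [_ inj] := cs_M_submanifold C.
  rewrite /TM limg_dim_eq ?capfv ?inj //.
  have [U [s [_ Ux _ /(_ _ Ux) bF]]] := cs_F_subbundle x.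
  have sz : size [seq s i x | i : 'I_r] == r.
    by rewrite size_map -cardE card_ord.
  by rewrite (size_basis (X := Tuple sz) bF) hrank dimvf /dim /= mul1n.
have piR : reeb_HM x = reeb_bar_HM x.
  exact: (proj_eq_on_F (hreeb x) (hFperp x) (htrans x) dimFT (hreeb x)).
have LE a b : Lambda_HM x a b = Lambda_bar_HM x a b.
  exact: (jacobi_proj_eq (hreeb x) (hFperp x) (htrans x) dimFT).
by rewrite /nh_bracket /P_nh_bracket LE piR.
Qed.
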